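(* Let $\mathcal{C}$ be a category and let $\mathcal{T}=(\mathcal{T},u,\mu)$ be a flow on $\mathcal{C}$. Then the interleaving distance $d_{(\mathcal{C},\mathcal{T})}$ is an extended pseudometric on the class of objects $\mathrm{obj}\,\mathcal{C}$; that is, $d_{(\mathcal{C},\mathcal{T})}$ takes values in $[0,\infty]$ and for all objects $a,b,c$ of $\mathcal{C}$ one has $d_{(\mathcal{C},\mathcal{T})}(a,a)=0$, $d_{(\mathcal{C},\mathcal{T})}(a,b)=d_{(\mathcal{C},\mathcal{T})}(b,a)$ and $d_{(\mathcal{C},\mathcal{T})}(a,c)\le d_{(\mathcal{C},\mathcal{T})}(a,b)+d_{(\mathcal{C},\mathcal{T})}(b,c)$.
   Context: A flow $\mathcal{T}=(\mathcal{T},u,\mu)$ on a category $\mathcal{C}$ consists of: a functor $\mathcal{T}:([0,\infty),\le)\to\mathrm{End}(\mathcal{C})$, $\varepsilon\mapsto\mathcal{T}_\varepsilon$ (where $\mathrm{End}(\mathcal{C})$ is the category of endofunctors of $\mathcal{C}$ and natural transformations; the natural transformation assigned to $\varepsilon\le\zeta$ is written $\mathcal{T}_{(\varepsilon\le\zeta)}:\mathcal{T}_\varepsilon\Rightarrow\mathcal{T}_\zeta$); a natural transformation $u:I_{\mathcal{C}}\Rightarrow\mathcal{T}_0$; and natural transformations $\mu_{\varepsilon,\zeta}:\mathcal{T}_\varepsilon\mathcal{T}_\zeta\Rightarrow\mathcal{T}_{\varepsilon+\zeta}$ for all $\varepsilon,\zeta\ge0$; such that for all $\varepsilon,\zeta,\delta,\kappa\ge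 0$: (i) $\mu_{0,\varepsilon}\circ(u\,\mathcal{T}_\varepsilon)=\mathrm{id}_{\mathcal{T}_\varepsilon}$ and $\mu_{\varepsilon,0}\circ(\mathcal{T}_\varepsilon u)=\mathrm{id}_{\mathcal{T}_\varepsilon}$; (ii) $\mu_{\varepsilon,\zeta+\delta}\circ(\mathcal{T}_\varepsilon\mu_{\zeta,\delta})=\mu_{\varepsilon+\zeta,\delta}\circ(\mu_{\varepsilon,\zeta}\mathcal{T}_\delta)$; (iii) $\mu_{\delta,\kappa}\circ(\mathcal{T}_{(\varepsilon\le\delta)}\mathcal{T}_{(\zeta\le\kappa)})=\mathcal{T}_{(\varepsilon+\zeta\le\delta+\kappa)}\circ\mu_{\varepsilon,\zeta}$ whenever $\varepsilon\le\delta$ and $\zeta\le\kappa$ (with $\mathcal{T}_{(\varepsilon\le\delta)}\mathcal{T}_{(\zeta\le\kappa)}$ the horizontal composite). A weak $\varepsilon$-interleaving of objects $a,b$ of $\mathcal{C}$ is a pair of morphisms $\varphi:a\to\mathcal{T}_\varepsilon b$, $\psi:b\to\mathcal{T}_\varepsilon a$ such that $\mu_{\varepsilon,\varepsilon,a}\circ\mathcal{T}_\varepsilon\psi\circ\varphi=\mathcal{T}_{(0\le2\varepsilon),a}\circ u_a$ and $\mu_{\varepsilon,\varepsilon,b}\circ\mathcal{T}_\varepsilon\varphi\circ\psi=\mathcal{T}_{(0\le2\varepsilon),b}\circ u_b$. Objects $a,b$ are weakly $\varepsilon$-interleaved if such a pair exists. The interleaving distance is $d_{(\mathcal{C},\mathcal{T})}(a,b)=\inf\{\varepsilon\ge0\mid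 a,b\text{ are weakly }\varepsilon\text{-interleaved}\}$, with value $\infty$ if $a,b$ are not weakly $\varepsilon$-interleaved for any $\varepsilon$. *)

(* Defs.v *)
From HB Require Import structures.
From mathcomp Require Import all_boot all_order all_algebra.
From mathcomp Require Import boolp classical_sets.
From mathcomp Require Import reals interval_inference constructive_ereal ereal.

Set Implicit Arguments.
Unset Strict Implicit.
Unset Printing Implicit Defensive.

Import Order.TTheory GRing.Theory Num.Theory.

Declare Scope cat_scope.
Delimit Scope cat_scope with cat.
Local Open Scope cat_scope.
Local Open Scope classical_set_scope.
Local Open Scope ring_scope.

Reserved Notation "g ∘ f" (at level 40, left associativity).

Record category := Category {
  obj :> Type;
  mor : obj -> obj -> Type;
  idmor : forall a, mor a a;
  compm : forall a b c, mor b c -> mor a b -> mor a c;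
  compm1 : forall a b (f : mor a b), compm f (idmor a) = f;
  comp1m : forall a b (f : mor a b), compm (idmor b) f = f;
  compmA : forall a b c d (h : mor c d) (g : mor b c) (f : mor a b),
    compm h (compm g f) = compm (compm h g) f }.

Arguments mor {_} _ _.
Arguments idmor {_} _.
Arguments compm {_ _ _ _} _ _.
Notation "g ∘ f" := (compm g f) : cat_scope.

Record functor (C D : category) := Functor {
  fobj :> C -> D;
  fmor : forall a b, mor a b -> mor (fobj a) (fobj b);
  fmor1 : forall a, fmor (idmor a) = idmor (fobj a);
  fmorM : forall a b c (g : mor b c) (f : mor a b),
    fmor (g ∘ f) = fmor g ∘ fmor f }.

Arguments fmor {C D} _ {a b} _.

Record nat_trans (C D : category) (F G : functor C D) := NatTrans {
  component :> forall a, mor (F a) (G a);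
  naturality : forall a b (f : mor a b),
    component b ∘ fmor F f = fmor G f ∘ component a }.

Lemma nat_trans_eq (C D : category) (F G : functor C D)
    (alpha beta : nat_trans F G) :
  (forall a, alpha a = beta a) -> alpha = beta.
Proof.
case: alpha beta => [x nx] [y ny] /= xy.
have {}xy : x = y by apply: functional_extensionality_dep.
by case: _ / xy ny => ny; congr NatTrans; exact: Prop_irrelevance.
Qed.

Definition functor_id (C : category) : functor C C :=
  @Functor C C id (fun _ _ f => f) (fun _ => erefl) (fun _ _ _ _ _ => erefl).

Section FunctorComposition.
Variables (C D E : category) (G : functor D E) (F : functor C D).

Lemma functor_comp1 a : fmor G (fmor F (idmor a)) = idmor (G (F a)).
Proof. by rewrite !fmor1. Qed.

Lemma functor_compM a b c (g : mor b c) (f : mor a b) :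
  fmor G (fmor F (g ∘ f)) = fmor G (fmor F g) ∘ fmor G (fmor F f).
Proof. by rewrite !fmorM. Qed.

Definition functor_comp : functor C E :=
  @Functor C E (fun a => G (F a)) (fun a b f => fmor G (fmor F f))
    functor_comp1 functor_compM.

End FunctorComposition.

Section NatTransOperations.
Variables C D : category.

Lemma nat_id_natural (F : functor C D) a b (f : mor a b) :
  idmor (F b) ∘ fmor F f = fmor F f ∘ idmor (F a).
Proof. by rewrite comp1m compm1. Qed.

Definition nat_id (F : functor C D) : nat_trans F F :=
  @NatTrans C D F F (fun a => idmor (F a)) (@nat_id_natural F).

Lemma vcomp_natural (F G H : functor C D)
    (beta : nat_trans G H) (alpha : nat_trans F G) a b (f : mor a b) :
  (beta b ∘ alpha b) ∘ fmor F f = fmor H f ∘ (beta a ∘ alpha a).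
Proof. by rewrite -compmA naturality compmA naturality compmA. Qed.

Definition vcomp (F G H : functor C D)
    (beta : nat_trans G H) (alpha : nat_trans F G) : nat_trans F H :=
  @NatTrans C D F H (fun a => beta a ∘ alpha a) (vcomp_natural beta alpha).

End NatTransOperations.

Section FunctorCategory.
Variables C D : category.

Lemma vcomp1 (F G : functor C D) (alpha : nat_trans F G) :
  vcomp alpha (nat_id F) = alpha.
Proof. by apply: nat_trans_eq => a; exact: compm1. Qed.

Lemma vcomp1l (F G : functor C D) (alpha : nat_trans F G) :
  vcomp (nat_id G) alpha = alpha.
Proof. by apply: nat_trans_eq => a; exact: comp1m. Qed.

Lemma vcompA (F G H K : functor C D) (gamma : nat_trans H K)
    (beta : nat_trans G H) (alpha : nat_trans F G) :
  vcomp gamma (vcomp beta alpha) = vcomp (vcomp gamma beta) alpha.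
Proof. by apply: nat_trans_eq => a; exact: compmA. Qed.

Definition functor_category : category :=
  Category vcomp1 vcomp1l vcompA.

End FunctorCategory.

Definition endo_category (C : category) : category := functor_category C C.

Section Whiskering.
Variables C D E : category.

Lemma hcomp_natural (G G' : functor D E) (F F' : functor C D)
    (beta : nat_trans G G') (alpha : nat_trans F F') a b (f : mor a b) :
  (beta (F' b) ∘ fmor G (alpha b)) ∘ fmor (functor_comp G F) f =
  fmor (functor_comp G' F') f ∘ (beta (F' a) ∘ fmor G (alpha a)).
Proof.
by rewrite /= -compmA -fmorM (naturality alpha) fmorM compmA naturality compmA.
Qed.

Definition hcomp (G G' : functor D E) (F F' : functor C D)
    (beta : nat_trans G G') (alpha : nat_trans F F') :
    nat_trans (functor_comp G F) (functor_comp G' F') :=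
  @NatTrans C E (functor_comp G F) (functor_comp G' F')
    (fun a => beta (F' a) ∘ fmor G (alpha a)) (hcomp_natural beta alpha).

Lemma whiskerl_natural (G : functor D E) (F F' : functor C D)
    (alpha : nat_trans F F') a b (f : mor a b) :
  fmor G (alpha b) ∘ fmor (functor_comp G F) f =
  fmor (functor_comp G F') f ∘ fmor G (alpha a).
Proof. by rewrite /= -!fmorM naturality. Qed.

Definition whiskerl (G : functor D E) (F F' : functor C D)
    (alpha : nat_trans F F') :
    nat_trans (functor_comp G F) (functor_comp G F') :=
  @NatTrans C E (functor_comp G F) (functor_comp G F')
    (fun a => fmor G (alpha a)) (whiskerl_natural G alpha).

Lemma whiskerr_natural (G G' : functor D E) (beta : nat_trans G G')
    (F : functor C D) a b (f : mor a b) :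
  beta (F b) ∘ fmor (functor_comp G F) f =
  fmor (functor_comp G' F) f ∘ beta (F a).
Proof. exact: (naturality beta (fmor F f)). Qed.

Definition whiskerr (G G' : functor D E) (beta : nat_trans G G')
    (F : functor C D) : nat_trans (functor_comp G F) (functor_comp G' F) :=
  @NatTrans C E (functor_comp G F) (functor_comp G' F)
    (fun a => beta (F a)) (whiskerr_natural beta F).

End Whiskering.

Section PosetCategory.
Variables (d : Order.disp_t) (P : porderType d).

Definition poset_comp (x y z : P) (yz : (y <= z)%O) (xy : (x <= y)%O) :
  (x <= z)%O := le_trans xy yz.

Definition poset_category : category :=
  @Category P (fun x y => (x <= y)%O) (fun x => lexx x) poset_comp
    (fun _ _ _ => bool_irrelevance _ _) (fun _ _ _ => bool_irrelevance _ _)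
    (fun _ _ _ _ _ _ _ => bool_irrelevance _ _).

End PosetCategory.

Section NonnegativeReals.
Variable R : realType.
Implicit Types e z t : {nonneg R}.

Definition nng0 : {nonneg R} := 0%:nng.
Definition nngD e z : {nonneg R} := (e%:num + z%:num)%:nng.

Lemma nng0D e : nngD nng0 e = e.
Proof. by apply/val_inj; rewrite /= add0r. Qed.

Lemma nngD0 e : nngD e nng0 = e.
Proof. by apply/val_inj; rewrite /= addr0. Qed.

Lemma nngDA e z t : nngD e (nngD z t) = nngD (nngD e z) t.
Proof. by apply/val_inj; rewrite /= addrA. Qed.

Lemma nng_ge0 e : nng0 <= e.
Proof. by rewrite -num_le /=. Qed.

Lemma nng_leD e z t k : e <= t -> z <= k -> nngD e z <= nngD t k.
Proof. by rewrite -!num_le /=; exact: lerD. Qed.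

End NonnegativeReals.

Arguments nng0 {R}.

Section Flow.
Variables (R : realType) (C : category).

Definition nng_family :=
  functor (poset_category {nonneg R}) (endo_category C).

Definition level (T : nng_family) (e : {nonneg R}) : functor C C := T e.

Definition level_le (T : nng_family) (e z : {nonneg R}) (ez : e <= z) :
  nat_trans (level T e) (level T z) := fmor T ez.

(* [level T (0 + e)] and [level T e] are equal but not convertible, and the  *)
(* same goes for the two bracketings of a sum of three indices; [level_eq]   *)
(* is the identity transformation carried along such an equality of indices. *)
Definition level_eq (T : nng_family) (e z : {nonneg R}) (ez : e = z) :
    nat_trans (level T e) (level T z) :=
  match ez in _ = t return nat_trans (level T e) (level T t) with
  | erefl => nat_id (level T e)
  end.

(* The axioms are equalities of natural transformations, stated at each      *)
(* object because the functors [I T_e] and [T_e], as well as the two         *)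
(* bracketings of a triple composite, are only propositionally equal.        *)
Record flow := Flow {
  flow_functor :> nng_family;
  flow_unit : nat_trans (functor_id C) (level flow_functor nng0);
  flow_mul : forall e z : {nonneg R},
    nat_trans (functor_comp (level flow_functor e) (level flow_functor z))
              (level flow_functor (nngD e z));
  flow_unitl : forall (e : {nonneg R}) (a : C),
    level_eq flow_functor (nng0D e) a
      ∘ (flow_mul nng0 e a ∘ whiskerr flow_unit (level flow_functor e) a)
    = idmor (level flow_functor e a);
  flow_unitr : forall (e : {nonneg R}) (a : C),
    level_eq flow_functor (nngD0 e) a
      ∘ (flow_mul e nng0 a ∘ whiskerl (level flow_functor e) flow_unit a)
    = idmor (level flow_functor e a);
  flow_mulA : forall (e z t : {nonneg R}) (a : C),
    level_eq flow_functor (nngDA e z t) a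
      ∘ (flow_mul e (nngD z t) a
           ∘ whiskerl (level flow_functor e) (flow_mul z t) a)
    = flow_mul (nngD e z) t a
        ∘ whiskerr (flow_mul e z) (level flow_functor t) a;
  flow_mul_level_le : forall (e z t k : {nonneg R})
      (et : e <= t) (zk : z <= k) (a : C),
    flow_mul t k a
      ∘ hcomp (level_le flow_functor et) (level_le flow_functor zk) a
    = level_le flow_functor (nng_leD et zk) a ∘ flow_mul e z a }.

End Flow.

Section Interleaving.
Variables (R : realType) (C : category) (T : flow R C).

Definition weak_interleaving (e : {nonneg R}) (a b : C)
    (phi : mor a (level T e b)) (psi : mor b (level T e a)) : Prop :=
  flow_mul T e e a ∘ fmor (level T e) psi ∘ phi
    = level_le T (nng_ge0 (nngD e e)) a ∘ flow_unit T a /\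
  flow_mul T e e b ∘ fmor (level T e) phi ∘ psi
    = level_le T (nng_ge0 (nngD e e)) b ∘ flow_unit T b.

Definition weakly_interleaved (e : {nonneg R}) (a b : C) : Prop :=
  exists (phi : mor a (level T e b)) (psi : mor b (level T e a)),
    weak_interleaving phi psi.

(* [ereal_inf set0 = +oo] *)
Definition interleaving_distance (a b : C) : \bar R :=
  ereal_inf [set e%:num%:E | e in [set e | weakly_interleaved e a b]].

End Interleaving.

Definition extended_pseudometric (R : realType) (X : Type)
    (d : X -> X -> \bar R) : Prop :=
  [/\ forall a b, (0 <= d a b)%E,
      forall a, d a a = 0%E,
      forall a b, d a b = d b a &
      forall a b c, (d a c <= d a b + d b c)%E].

(* Main.v *)
Require Import Defs.
From mathcomp Require Import all_boot all_order all_algebra.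
From mathcomp Require Import classical_sets.
From mathcomp Require Import reals interval_inference constructive_ereal ereal.

(** Nonnegativity is clear, symmetry holds because the two equations of a weak
    interleaving are exchanged when its two morphisms are, and the unit of the
    flow, used in both directions, is a weak 0-interleaving of an object with
    itself.  The content is the triangle inequality, which follows on taking
    infima once weak interleavings [(phi, psi)] of [a, b] at [e] and
    [(phi', psi')] of [b, c] at [z] compose to one of [a, c] at [e + z].

    The composite morphisms are the Kleisli composites
    [a -> T_e b -> T_e T_z c -> T_(e+z) c] and
    [c -> T_z b -> T_z T_e a -> T_(z+e) a].  Going from [a] to [c] and back,
    associativity of the multiplication brings the two middle morphisms [phi']
    and [psi'] together; they collapse to the unit at [b] followed by a
    transition of the flow.  By naturality [psi] moves past that unit, which the
    unit law absorbs; the remaining [phi] and [psi] then collapse in turn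
    ([kleisli_round_trip]).

    The indices [z + e] and [e + z], or the two bracketings of a triple sum, are
    equal only up to a proof.  All such mismatches are handled by composing the
    multiplication with a transition into an arbitrary upper bound of the sum
    ([mul_to]).  Since transitions compose and do not depend on the proof of the
    inequality that indexes them, the laws of a flow become equations
    between morphisms [mul_to] in which the bounds are arbitrary and no transport
    along an equality of indices occurs. *)

Set Implicit Arguments.
Unset Strict Implicit.
Unset Printing Implicit Defensive.

Import Order.TTheory GRing.Theory Num.Theory.

Local Open Scope cat_scope.
Local Open Scope classical_set_scope.
Local Open Scope ring_scope.

(** * Flows with multiplication into arbitrary bounds *)

Section FlowLaws.
Variables (R : realType) (C : category) (T : flow R C).
Implicit Types (e z t w : {nonneg R}) (a b c : C).

Notation lev := (level T).

Definition transition e z (ez : e <= z) a : mor (lev e a) (lev z a) :=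
  level_le T ez a.

Definition unit_at a : mor a (lev nng0 a) := flow_unit T a.

(** Locked, since otherwise rewriting with associativity would see through it
    and split the composite. *)
Definition mul_to e z w (ezw : nngD e z <= w) a :
    mor (lev e (lev z a)) (lev w a) :=
  locked (transition ezw a ∘ flow_mul T e z a).

Lemma mul_toE e z w (ezw : nngD e z <= w) a :
  mul_to ezw a = transition ezw a ∘ flow_mul T e z a.
Proof. by rewrite /mul_to; unlock. Qed.

Lemma transition_refl e (ee : e <= e) a : transition ee a = idmor (lev e a).
Proof.
rewrite /transition /level_le (_ : ee = @idmor (poset_category {nonneg R}) e).
  by rewrite fmor1.
exact: bool_irrelevance.
Qed.

Lemma transition_trans e z t (ez : e <= z) (zt : z <= t) (et : e <= t) a :
  transition zt a ∘ transition ez a = transition et a.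
Proof.
rewrite /transition /level_le.
rewrite (_ : et = @compm (poset_category {nonneg R}) e z t zt ez).
  by rewrite fmorM.
exact: bool_irrelevance.
Qed.

Lemma transition_natural e z (ez : e <= z) a b (f : mor a b) :
  transition ez b ∘ fmor (lev e) f = fmor (lev z) f ∘ transition ez a.
Proof. exact: (naturality (level_le T ez)). Qed.

Lemma unit_natural a b (f : mor a b) :
  unit_at b ∘ f = fmor (lev nng0) f ∘ unit_at a.
Proof. exact: (naturality (flow_unit T)). Qed.

Lemma mul_to_natural e z w (ezw : nngD e z <= w) a b (f : mor a b) :
  mul_to ezw b ∘ fmor (lev e) (fmor (lev z) f)
  = fmor (lev w) f ∘ mul_to ezw a.
Proof.
rewrite !mul_toE -compmA.
have -> := naturality (flow_mul T e z) f.
by rewrite compmA transition_natural -compmA.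
Qed.

(** Transport along an equality of indices is a transition, so that the
    transports in the axioms are absorbed by thinness of the index poset. *)
Lemma level_eq_transition e z (ez : e = z) (lez : e <= z) a :
  level_eq T ez a = transition lez a.
Proof. by case: _ / ez lez => lez; rewrite transition_refl. Qed.

Lemma transition_mul_to e z w w' (ezw : nngD e z <= w) (ww' : w <= w')
    (ezw' : nngD e z <= w') a :
  transition ww' a ∘ mul_to ezw a = mul_to ezw' a.
Proof. by rewrite !mul_toE compmA (transition_trans _ _ ezw'). Qed.

Lemma mul_to_transitionl e e' z w (ee' : e <= e') (e'zw : nngD e' z <= w)
    (ezw : nngD e z <= w) a :
  mul_to e'zw a ∘ transition ee' (lev z a) = mul_to ezw a.
Proof.
have := flow_mul_level_le T ee' (lexx z) a.
rewrite /= -!/(transition _ _) transition_refl fmor1 compm1 => H.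
rewrite !mul_toE -compmA H compmA.
by rewrite (transition_trans _ _ ezw).
Qed.

Lemma mul_to_transitionr e z z' w (zz' : z <= z') (ez'w : nngD e z' <= w)
    (ezw : nngD e z <= w) a :
  mul_to ez'w a ∘ fmor (lev e) (transition zz' a) = mul_to ezw a.
Proof.
have := flow_mul_level_le T (lexx e) zz' a.
rewrite /= -!/(transition _ _) transition_refl comp1m => H.
rewrite !mul_toE -compmA H compmA.
by rewrite (transition_trans _ _ ezw).
Qed.

Lemma mul_to_unitl e w (ew : e <= w) (ow : nngD nng0 e <= w) a :
  mul_to ow a ∘ unit_at (lev e a) = transition ew a.
Proof.
have oe : nngD nng0 e <= e by rewrite nng0D.
rewrite -(transition_mul_to oe ew) -compmA !mul_toE.
have := flow_unitl T e a.
rewrite (level_eq_transition _ oe) /= compmA => H.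
by rewrite H compm1.
Qed.

Lemma mul_to_unitr e w (ew : e <= w) (eow : nngD e nng0 <= w) a :
  mul_to eow a ∘ fmor (lev e) (unit_at a) = transition ew a.
Proof.
have eo : nngD e nng0 <= e by rewrite nngD0.
rewrite -(transition_mul_to eo ew) -compmA !mul_toE.
have := flow_unitr T e a.
rewrite (level_eq_transition _ eo) /= compmA => H.
by rewrite H compm1.
Qed.

Lemma mul_toA e z t p q w (ztp : nngD z t <= p) (epw : nngD e p <= w)
    (ezq : nngD e z <= q) (qtw : nngD q t <= w) a :
  mul_to epw a ∘ fmor (lev e) (mul_to ztp a)
  = mul_to qtw a ∘ mul_to ezq (lev t a).
Proof.
have eztw : nngD e (nngD z t) <= w.
  exact: le_trans (nng_leD (lexx e) ztp) epw.
have eztw' : nngD (nngD e z) t <= w by rewrite -nngDA.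
have ezt : nngD e (nngD z t) <= nngD (nngD e z) t by rewrite nngDA.
rewrite (mul_toE ztp) (mul_toE ezq) fmorM !compmA.
rewrite (mul_to_transitionr _ _ eztw) (mul_to_transitionl _ _ eztw').
rewrite !mul_toE -(transition_trans ezt eztw' eztw).
have := flow_mulA T e z t a.
rewrite (level_eq_transition _ ezt) /= => H.
by rewrite -!compmA H.
Qed.

(** * Weak interleavings *)

Definition kleisli e z w (ezw : nngD e z <= w) a b c
    (g : mor b (lev z c)) (f : mor a (lev e b)) : mor a (lev w c) :=
  mul_to ezw c ∘ fmor (lev e) g ∘ f.

(** One of the two equations of a weak interleaving.  Leaving [w] free, instead
    of taking [e + e], lets the equation apply to trips made inside larger
    composites, whose bounds are other sums of indices. *)
Definition round_trip e a b (f : mor a (lev e b)) (g : mor b (lev e a)) :=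
  forall w (eew : nngD e e <= w) (ow : nng0 <= w),
    kleisli eew g f = transition ow a ∘ unit_at a.

Lemma weak_interleavingE e a b (f : mor a (lev e b)) (g : mor b (lev e a)) :
  weak_interleaving f g <-> round_trip f g /\ round_trip g f.
Proof.
have half a' b' (f' : mor a' (lev e b')) (g' : mor b' (lev e a')) :
  flow_mul T e e a' ∘ fmor (lev e) g' ∘ f'
    = level_le T (nng_ge0 (nngD e e)) a' ∘ flow_unit T a'
  <-> round_trip f' g'.
  split=> [H w eew ow|H].
    rewrite /kleisli !mul_toE -!compmA (compmA (flow_mul T e e a')) H compmA.
    by rewrite -/(transition _ _) (transition_trans _ _ ow).
  have := H _ (lexx _) (nng_ge0 _).
  by rewrite /kleisli !mul_toE transition_refl comp1m.
by split=> [[/half ? /half ?]|[/half ? /half ?]].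
Qed.

(** The bound [d] is free because the two composites have [e + z] and [z + e] as
    their sums of indices, and because exchanging the roles of the two pairs then
    turns this into the other equation of the composite interleaving. *)
Lemma kleisli_round_trip e z d (ezd : nngD e z <= d) (zed : nngD z e <= d)
    a b c (f : mor a (lev e b)) (g : mor b (lev e a))
    (f' : mor b (lev z c)) (g' : mor c (lev z b)) :
  round_trip f g -> round_trip f' g' ->
  round_trip (kleisli ezd f' f) (kleisli zed g g').
Proof.
move=> fg f'g' w ddw ow.
set p := nngD z d.
have epw : nngD e p <= w.
  by rewrite /p nngDA; apply: le_trans ddw; exact: nng_leD.
have zzep : nngD (nngD z z) e <= p by rewrite -nngDA; exact: nng_leD.
have oep : nngD nng0 e <= p.
  by apply: le_trans zzep; apply: nng_leD; rewrite ?nng_ge0.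
have ep : e <= p by rewrite -(nng0D e).
have eew : nngD e e <= w by apply: le_trans epw; exact: nng_leD.
(* Everything to the right of [g] forms the trip of [f'] and [g'], hence a unit;
   naturality moves that unit to [T_e a], where the unit law removes it. *)
have inner : mul_to (lexx p) a ∘ fmor (lev z) (kleisli zed g g') ∘ f'
             = transition ep a ∘ g.
  rewrite /kleisli !fmorM !compmA (mul_toA _ _ (lexx _) zzep).
  rewrite -(compmA _ _ (fmor _ (fmor _ g))) mul_to_natural -!compmA.
  rewrite (compmA (mul_to (lexx _) _)) -/(kleisli (lexx _) g' f').
  rewrite (f'g' _ _ (nng_ge0 _)) (compmA (fmor _ g)) -transition_natural.
  rewrite -compmA -unit_natural !compmA (mul_to_transitionl _ _ oep).
  by rewrite (mul_to_unitl ep).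
rewrite {1}/kleisli -(fg _ eew ow) /kleisli -/(kleisli zed g g').
rewrite !compmA -(compmA _ _ (mul_to ezd c)) -mul_to_natural.
rewrite !compmA -(mul_toA (lexx p) epw) -!compmA.
rewrite (compmA (fmor _ (fmor _ _)) (fmor _ f')) -fmorM.
rewrite (compmA (fmor _ (mul_to _ _))) -fmorM (compmA (mul_to (lexx p) a)) inner.
by rewrite fmorM !compmA (mul_to_transitionr _ _ eew).
Qed.

Lemma weakly_interleaved_refl a : weakly_interleaved T nng0 a a.
Proof.
exists (unit_at a), (unit_at a); rewrite weak_interleavingE.
suff uu : round_trip (unit_at a) (unit_at a) by [].
by move=> w oow ow; rewrite /kleisli (mul_to_unitr ow).
Qed.

Lemma weakly_interleaved_sym e a b :
  weakly_interleaved T e a b -> weakly_interleaved T e b a.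
Proof. by move=> [f [g [fg gf]]]; exists g, f; split. Qed.

Lemma weakly_interleaved_trans e z a b c :
  weakly_interleaved T e a b -> weakly_interleaved T z b c ->
  weakly_interleaved T (nngD e z) a c.
Proof.
move=> [f [g /weak_interleavingE[fg gf]]].
move=> [f' [g' /weak_interleavingE[f'g' g'f']]].
have zed : nngD z e <= nngD e z by rewrite -num_le /= addrC.
exists (kleisli (lexx _) f' f), (kleisli zed g g').
by apply/weak_interleavingE; split; exact: kleisli_round_trip.
Qed.

(** * The interleaving distance *)

Lemma interleaving_distance_le e a b :
  weakly_interleaved T e a b -> (interleaving_distance T a b <= e%:num%:E)%E.
Proof. by move=> eab; apply: ereal_inf_lbound; exists e. Qed.

Lemma le_interleaving_distance (x : \bar R) a b :
  (forall e, weakly_interleaved T e a b -> (x <= e%:num%:E)%E) ->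
  (x <= interleaving_distance T a b)%E.
Proof. by move=> xab; apply: le_ereal_inf_tmp => _ [e eab <-]; exact: xab. Qed.

Lemma interleaving_distance_ge0 a b : (0 <= interleaving_distance T a b)%E.
Proof. by apply: le_interleaving_distance => e _; rewrite lee_fin. Qed.

Lemma interleaving_distance_refl a : interleaving_distance T a a = 0%E.
Proof.
apply/eqP; rewrite eq_le interleaving_distance_ge0 andbT.
exact: (interleaving_distance_le (weakly_interleaved_refl a)).
Qed.

Lemma interleaving_distance_sym a b :
  interleaving_distance T a b = interleaving_distance T b a.
Proof.
by apply/eqP; rewrite eq_le; apply/andP; split;
  apply: le_interleaving_distance => e /weakly_interleaved_sym;
  exact: interleaving_distance_le.
Qed.

(** The two infima on the right are taken one after the other; subtracting the
    distance from [b] to [c] requires it to be finite, and if it is infinite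
    then so is the right-hand side. *)
Lemma interleaving_distance_triangle a b c :
  (interleaving_distance T a c
   <= interleaving_distance T a b + interleaving_distance T b c)%E.
Proof.
have [bc_fin|] := boolP (interleaving_distance T b c \is a fin_num); last first.
  rewrite ge0_fin_numE ?interleaving_distance_ge0// ltey negbK => /eqP ->.
  by rewrite addey ?leey// gt_eqF// (lt_le_trans _ (interleaving_distance_ge0 _ _)).
rewrite -leeBlDr//; apply: le_interleaving_distance => e eab.
rewrite leeBlDr// -leeBlDl//; apply: le_interleaving_distance => z zbc.
rewrite leeBlDl// -EFinD.
exact: (interleaving_distance_le (weakly_interleaved_trans eab zbc)).
Qed.

End FlowLaws.

Theorem theorem2p5 (R : realType) (C : category) (T : flow R C) :
  extended_pseudometric (interleaving_distance T).
Proof.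
split.
- exact: interleaving_distance_ge0.
- exact: interleaving_distance_refl.
- exact: interleaving_distance_sym.
- exact: interleaving_distance_triangle.
Qed.
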